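(* Consider the regularized loss minimization problem $$\min_{\theta\in\Theta}\ \kappa\mathcal{R}(\theta)+\frac1N\sum_{i=1}^N\ell_\theta(\hat s_i,\hat x_i),\qquad \ell_\theta(\hat s,\hat x):=\max_{x\in\mathbb{X}(\hat s)}\big\{\langle\theta,\phi(\hat s,\hat x)-\phi(\hat s,x)\rangle+d(\hat x,x)\big\},$$ with the mixed-integer feasible set $$\mathbb{X}(\hat s)=\big\{(y,z)\in\mathbb{R}^u\times\mathbb{Z}^v:\ \hat Ay+\hat Bz\le\hat c,\ z\in\mathbb{Z}(\hat w)\big\},\qquad \hat s=(\hat A,\hat B,\hat c,\hat w),$$ the hypothesis function (linear in $y$; with $x=(y,z)$, $\theta=(\operatorname{vec}(Q),q)$) $$\langle\theta,\phi(s,x)\rangle=\langle y,Q\phi_1(w,z)\rangle+\langle q,\phi_2(w,z)\rangle,$$ and the distance function $d(\hat x,x)=\|\hat y-y\|_\infty+d_z(\hat z,z)$. Then this problem can be reformulated as $$\begin{aligned}\min\quad&\kappa\mathcal{R}(\theta)+\frac1N\sum_{i=1}^N\beta_i\\ \text{s.t.}\quad&\theta=(\operatorname{vec}(Q),q)\in\Theta,\quad\lambda_{ijk}\ge0,\quad\beta_i\in\mathbb{R}\\ &\langle\theta,\phi(\hat s_i,\hat x_i)\rangle+\langle\lambda_{ijk},\hat c_i-\hat B_iz_{ij}\rangle-\langle q,\phi_2(\hat w_i,z_{ij})\rangle+\langle h_k,\hat y_i\rangle+d_z(\hat z_i,z_{ij})\le\beta_i\\ &Q\phi_1(\hat w_i,z_{ij})+h_k+\hat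 A_i^\top\lambda_{ijk}=0,\end{aligned}$$ where the minimization is over $Q,q,\{\lambda_{ijk}\},\{\beta_i\}$, the constraints are for all $(i,j,k)\in[N]\times[M_i]\times[2u]$, $\mathbb{Z}(\hat w_i)=\{z_{i1},\dots,z_{iM_i}\}$, $M_i=|\mathbb{Z}(\hat w_i)|$, and if $k\le u$ (resp. $k>u$), $h_k\in\mathbb{R}^u$ is the vector of zeros except for the $k$-th (resp. $(k-u)$-th) element, which is equal to $1$ (resp. $-1$).
   Context: Data: signal-response pairs $\{(\hat s_i,\hat x_i)\}_{i=1}^N$ with $\hat s_i=(\hat A_i,\hat B_i,\hat c_i,\hat w_i)$ and $\hat x_i=(\hat y_i,\hat z_i)\in\mathbb{X}(\hat s_i)$. The set $\mathbb{Z}(\hat w)\subset\mathbb{Z}^v$ is bounded and may depend on $\hat w\in\mathbb{W}$. Here $Q\in\mathbb{R}^{u\times m}$, $q\in\mathbb{R}^r$; $\phi_1:\mathbb{W}\times\mathbb{Z}^v\to\mathbb{R}^m$ and $\phi_2:\mathbb{W}\times\mathbb{Z}^v\to\mathbb{R}^r$ are feature functions, and $\phi$ is the feature map determined by the displayed identity for $\langle\theta,\phi(s,x)\rangle$. $\mathcal{R}:\mathbb{R}^{um+r}\to\mathbb{R}$ is a regularization function, $\kappa\ge0$, $\Theta\subseteq\mathbb{R}^{um+r}$ is the set of admissible parameters, and $d_z:\mathbb{Z}^v\times\mathbb{Z}^v\to\mathbb{R}_+$ is a general distance function on the integer part. $\operatorname{vec}$ stacks the columns of a matrix; $[n]=\{1,\dots,n\}$.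 ''Can be reformulated as'' means the two optimization problems are equivalent (same optimal value and same optimal $\theta$).
   Formalization: Takes u ≥ 1 and adds a proviso, without which the claim fails: for θ in Θ with finite objective, each i, k and z in Z(ŵ_i), either some y has (y,z) in X(ŝ_i) or some λ ≥ 0 has Qφ_1(ŵ_i,z) + h_k + Â_i^T λ = 0. *)

(* Defs.v *)
(* MathComp / MathComp-Analysis, over an arbitrary R : realType. *)
From HB Require Import structures.
From mathcomp Require Import all_boot all_order all_algebra.
From mathcomp Require Import all_classical all_reals all_analysis.

Set Implicit Arguments.
Unset Strict Implicit.
Unset Printing Implicit Defensive.

Import Order.TTheory GRing.Theory Num.Theory.
Import numFieldNormedType.Exports.

Local Open Scope classical_set_scope.
Local Open Scope ring_scope.

Section LinearAlgebra.
Context {R : realType}.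

Definition dotp n (a b : 'cV[R]_n) : R := \sum_(i < n) a i 0 * b i 0.

Definition vle n (a b : 'cV[R]_n) : Prop := forall i, a i 0 <= b i 0.

Definition intv n (z : 'cV[int]_n) : 'cV[R]_n := map_mx intr z.

(* [mxvec] concatenates rows, so stacking columns is [mxvec] of the
   transpose; the length u * m therefore appears as m * u. *)
Definition vec u m (Q : 'M[R]_(u, m)) : 'cV[R]_(m * u) := (mxvec Q^T)^T.

Definition param u m r (Q : 'M[R]_(u, m)) (q : 'cV[R]_r) : 'cV[R]_(m * u + r) :=
  col_mx (vec Q) q.

(* Indices are zero-based: k < u gives the unit vector e_k, and
   u <= k < 2 * u gives - e_(k - u). *)
Definition hvec u (k : 'I_(2 * u)) : 'cV[R]_u :=
  \col_i (if (k < u)%N then ((i : nat) == k)%:R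
          else - ((i : nat) == k - u)%N%:R).

End LinearAlgebra.

Definition bounded_intset v (Z : set 'cV[int]_v) : Prop :=
  exists b : int, forall z, Z z -> forall l, `|z l 0| <= b.

Section Optimization.
Context {R : realType} {T : Type}.

Definition optimal_value (S : set T) (f : T -> \bar R) : \bar R :=
  ereal_inf [set f x | x in S].

(* An everywhere infinite objective has no minimizer: the value +oo stands
   for infeasibility. *)
Definition minimizer (S : set T) (f : T -> \bar R) (x : T) : Prop :=
  [/\ S x, (f x < +oo)%E & forall x', S x' -> (f x <= f x')%E].

End Optimization.

Section LossMinimization.
Context {R : realType} {S T : Type} {p : nat}.

(* The maximum of the loss may be infinite, hence a supremum in \bar R. *)
Definition subopt_loss (X : S -> set T) (phi : S -> T -> 'cV[R]_p)
    (d : T -> T -> R) (theta : 'cV[R]_p) (s : S) (xhat : T) : \bar R :=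
  ereal_sup [set (dotp theta (phi s xhat - phi s x) + d xhat x)%:E | x in X s].

Definition regularized_objective N (kappa : R) (Reg : 'cV[R]_p -> R)
    (loss : 'cV[R]_p -> S -> T -> \bar R) (s : 'I_N -> S) (xhat : 'I_N -> T)
    (theta : 'cV[R]_p) : \bar R :=
  ((kappa * Reg theta)%:E +
   (N%:R^-1)%:E * \sum_(i < N) loss theta (s i) (xhat i))%E.

End LossMinimization.

Section MixedInteger.
Context {R : realType} {t u v : nat} {W : Type}.

Record signal := Signal {
  sigA : 'M[R]_(t, u);
  sigB : 'M[R]_(t, v);
  sigc : 'cV[R]_t;
  sigw : W }.

Definition mi_feasible (Z : W -> set 'cV[int]_v) (s : signal) :
    set ('cV[R]_u * 'cV[int]_v) :=
  [set x | vle (sigA s *m x.1 + sigB s *m intv x.2) (sigc s) /\ Z (sigw s) x.2].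

(* On column vectors `|.| is the max norm. *)
Definition mi_dist (dz : 'cV[int]_v -> 'cV[int]_v -> R)
    (xhat x : 'cV[R]_u * 'cV[int]_v) : R :=
  `|xhat.1 - x.1| + dz xhat.2 x.2.

(* For fixed z and k, feasibility in the dual of
   max { - <y, Q phi1(w,z) + h_k> : A y <= c - B z } over y. *)
Definition dual_feasible m (phi1 : W -> 'cV[int]_v -> 'cV[R]_m) (s : signal)
    (Q : 'M[R]_(u, m)) (z : 'cV[int]_v) (k : 'I_(2 * u)) (l : 'cV[R]_t) : Prop :=
  vle 0 l /\ Q *m phi1 (sigw s) z + hvec k + (sigA s)^T *m l = 0.

End MixedInteger.

Arguments signal : clear implicits.

Section Reformulation.
Context {R : realType} {t u v m r N : nat} {W : Type}.
Variable M : 'I_N -> nat.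

Record ref_var := RefVar {
  rQ : 'M[R]_(u, m);
  rq : 'cV[R]_r;
  rlam : forall i : 'I_N, 'I_(M i) -> 'I_(2 * u) -> 'cV[R]_t;
  rbeta : 'I_N -> R }.

Definition rtheta (a : ref_var) : 'cV[R]_(m * u + r) := param (rQ a) (rq a).

Variables (phi1 : W -> 'cV[int]_v -> 'cV[R]_m)
          (phi2 : W -> 'cV[int]_v -> 'cV[R]_r)
          (phi : signal R t u v W -> 'cV[R]_u * 'cV[int]_v -> 'cV[R]_(m * u + r))
          (dz : 'cV[int]_v -> 'cV[int]_v -> R)
          (s : 'I_N -> signal R t u v W)
          (xhat : 'I_N -> 'cV[R]_u * 'cV[int]_v)
          (zs : forall i : 'I_N, 'I_(M i) -> 'cV[int]_v).

Definition ref_feasible (Theta : set 'cV[R]_(m * u + r)) : set ref_var :=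
  [set a | Theta (rtheta a) /\
    forall (i : 'I_N) (j : 'I_(M i)) (k : 'I_(2 * u)),
      dotp (rtheta a) (phi (s i) (xhat i))
        + dotp (rlam a j k) (sigc (s i) - sigB (s i) *m intv (zs j))
        - dotp (rq a) (phi2 (sigw (s i)) (zs j))
        + dotp (hvec k) (xhat i).1
        + dz (xhat i).2 (zs j) <= rbeta a i
      /\ dual_feasible phi1 (s i) (rQ a) (zs j) k (rlam a j k)].

Definition ref_objective (kappa : R) (Reg : 'cV[R]_(m * u + r) -> R)
    (a : ref_var) : R :=
  kappa * Reg (rtheta a) + N%:R^-1 * \sum_(i < N) rbeta a i.

End Reformulation.

Arguments ref_var : clear implicits.

(* Main.v *)
Require Import Defs.
From HB Require Import structures.
From mathcomp Require Import all_boot all_order all_algebra.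
From mathcomp Require Import all_classical all_reals all_analysis.
From mathcomp Require Import ring lra.

Set Implicit Arguments.
Unset Strict Implicit.
Unset Printing Implicit Defensive.

Import Order.TTheory GRing.Theory Num.Theory.
Import numFieldNormedType.Exports.

Local Open Scope classical_set_scope.
Local Open Scope ring_scope.

(** At a fixed parameter the condition [loss <= beta] for one sample says that a
    supremum over [(y, z)] is at most [beta], i.e. that for every integer point
    [z] the bound holds on the whole fiber of feasible [y]. The term
    [`|yhat - y|] is convex in [y], but for [0 < u] it is the maximum of the
    [2 * u] linear functionals [dotp (hvec k)] ([maxnorm_leP]); bounding it
    from above therefore splits the condition into one linear program per pair
    [(z, k)], each asserting that a linear functional of [y] is bounded on a
    polyhedron ([fiber_boundP]). Linear programming duality turns each of these
    into the existence of a multiplier [l >= 0] with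
    [Q phi1 + h_k + A^T l = 0] whose dual value is at most the bound
    ([fiber_bound_of_cuts], [cuts_of_fiber_bound]): this is one constraint of
    the reformulation, and [beta_i] plays the role of an epigraph variable.

    Weak duality gives that every point of the reformulation dominates the
    original objective at its own [theta]. Strong duality gives that every
    [theta] with finite objective lifts to a feasible point of the same value,
    on taking [beta_i] to be the loss itself, which is finite there because it is
    nonnegative: the observed response [xhat_i] is a competitor in its own
    supremum. These two facts alone identify the optimal values and the optimal
    parameters ([optimization_transfer]).

    Strong duality is [lp_strong_duality], obtained by homogenization from the
    Farkas lemma for linear functionals ([farkas]), which is proved by
    elimination of one functional at a time. It requires that the primal
    and the dual are not both infeasible, which the hypothesis on the inner
    programs provides wherever the objective is finite. *)

(** * The Farkas lemma for linear functionals *)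

Lemma scalarBZ (R : pzRingType) (V : lmodType R) (f : V -> R) (c : R)
    (x w : V) :
  scalar f -> f (x - c *: w) = f x - c * f w.
Proof. by move=> lf; rewrite addrC -scaleNr lf mulNr addrC. Qed.

(** Induction on the number of functionals. If the nonpositivity of the other
    functionals does not already force [g <= 0], some [w] violates that
    implication, and then [a_0 w > 0]. The map [x |-> x - (a_0 x / a_0 w) w]
    projects onto the kernel of [a_0]; after composition with it the other
    functionals satisfy the hypothesis without [a_0]. Undoing the projection
    gives [a_0] the multiplier [(g w - \sum_j l_j a_j w) / a_0 w], which is
    nonnegative because [g w > 0] while every [a_j w <= 0]. *)
Lemma farkas (R : realFieldType) (V : lmodType R) t (a : 'I_t -> V -> R)
    (g : V -> R) :
  (forall i, scalar (a i)) -> scalar g ->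
  (forall x, (forall i, a i x <= 0) -> g x <= 0) ->
  exists2 l : 'I_t -> R,
    forall i, 0 <= l i & forall x, g x = \sum_(i < t) l i * a i x.
Proof.
elim: t a g => [|t IH] a g la lg impl.
  exists (fun=> 0) => // x; rewrite big_ord0; apply/le_anti.
  (* Without constraints, [g] is nonpositive at [x] and at [- x]. *)
  have nonpos y : g y <= 0 by apply: impl => -[].
  have := nonpos (x - 2 *: x); rewrite scalarBZ //.
  by have := nonpos x; lra.
pose b i := a (lift ord0 i).
have lb i : scalar (b i) := la _.
have [bg|] := pselect (forall x, (forall i, b i x <= 0) -> g x <= 0).
  have [l l0 gE] := IH _ _ lb lg bg; exists (fun i => oapp l 0 (unlift ord0 i)).
    by move=> i; case: unliftP => /=.
  move=> x; rewrite gE big_ord_recl unlift_none mul0r add0r.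
  by apply: eq_bigr => i _; rewrite liftK.
move=> /existsNP[w /not_implyP[bw /negP]]; rewrite -ltNge => gw.
have aw : 0 < a ord0 w.
  rewrite ltNge; apply/negP => aw; move: gw; rewrite ltNge impl // => i.
  by case: (unliftP ord0 i) => [j ->|->//]; exact: bw.
pose proj (f : V -> R) x := f (x - (a ord0 x / a ord0 w) *: w).
have lproj f : scalar f -> scalar (proj f).
  by move=> lf c x y; rewrite /proj !(scalarBZ _ _ _ lf) lf la; field; lra.
have [||x bx|l l0 gE] := IH (fun i => proj (b i)) (proj g).
- by move=> i; exact: lproj.
- exact: lproj.
- apply: impl => i; case: (unliftP ord0 i) => [j ->|->]; first exact: bx.
  by rewrite scalarBZ // divfK ?gt_eqF // subrr.
(* The value at [ord0] is what the projection subtracts along [w]. *)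
exists (fun i => oapp l ((g w - \sum_(j < t) l j * b j w) / a ord0 w)
                     (unlift ord0 i)).
  move=> i; case: unliftP => //= _; apply: divr_ge0; last exact: ltW.
  rewrite subr_ge0 (le_trans _ (ltW gw)) // sumr_le0 // => j _.
  by rewrite mulr_ge0_le0.
move=> x; rewrite big_ord_recl unlift_none.
under [X in _ + X]eq_bigr => i _ do rewrite liftK /= -/(b i x).
have := gE x; rewrite /proj scalarBZ // => /eqP; rewrite subr_eq => /eqP ->.
under [X in X + _ = _]eq_bigr => i _ do
  rewrite scalarBZ // mulrBr [X in _ - X]mulrCA.
by rewrite sumrB -mulr_sumr /=; field; rewrite gt_eqF.
Qed.

(** * Linear programming duality *)

Section Dotp.
Variable R : realType.

Lemma dotpC n (a b : 'cV[R]_n) : dotp a b = dotp b a.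
Proof. by apply: eq_bigr => i _; rewrite mulrC. Qed.

Lemma dotp_linear n (a : 'cV[R]_n) : scalar (dotp a).
Proof.
move=> c x y; rewrite /dotp mulr_sumr -big_split /=.
by apply: eq_bigr => i _; rewrite !mxE mulrDr mulrCA.
Qed.

Lemma dotpDr n (a x y : 'cV[R]_n) : dotp a (x + y) = dotp a x + dotp a y.
Proof. by rewrite -[x]scale1r dotp_linear mul1r scale1r. Qed.

Lemma dotpNr n (a x : 'cV[R]_n) : dotp a (- x) = - dotp a x.
Proof. by rewrite /dotp -sumrN; apply: eq_bigr => i _; rewrite mxE mulrN. Qed.

Lemma dotpBr n (a x y : 'cV[R]_n) : dotp a (x - y) = dotp a x - dotp a y.
Proof. by rewrite dotpDr dotpNr. Qed.

Lemma dotp0r n (a : 'cV[R]_n) : dotp a 0 = 0.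
Proof. by rewrite -(subrr 0) dotpBr subrr. Qed.

Lemma dotp_trmx t n (A : 'M[R]_(t, n)) l y :
  dotp (A^T *m l) y = dotp l (A *m y).
Proof.
have dotpE k (a b : 'cV[R]_k) : dotp a b = (a^T *m b) 0 0.
  by rewrite mxE; apply: eq_bigr => i _; rewrite mxE.
by rewrite !dotpE trmx_mul trmxK mulmxA.
Qed.

Lemma mulmx_coord_linear t n (A : 'M[R]_(t, n)) j : 
  scalar (fun y : 'cV[R]_n => (A *m y) j 0).
Proof.
move=> c x y; rewrite mulmxDr -scalemxAr.
by rewrite [LHS]mxE [X in X + _]mxE.
Qed.

Lemma dotp_inj n (a b : 'cV[R]_n) : (forall y, dotp a y = dotp b y) -> a = b.
Proof.
move=> ab; apply/colP => i.
have dotp_delta (x : 'cV[R]_n) : dotp x (delta_mx i 0) = x i 0.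
  rewrite /dotp (bigD1 i) //= big1 ?mxE ?eqxx ?mulr1 ?addr0 // => j /negPf ji.
  by rewrite mxE ji mulr0.
by rewrite -!dotp_delta ab.
Qed.

Lemma dotp_le n (l x y : 'cV[R]_n) : vle 0 l -> vle x y -> dotp l x <= dotp l y.
Proof.
move=> l0 xy; apply: ler_sum => i _; apply: ler_wpM2l => //.
by have := l0 i; rewrite mxE.
Qed.

Lemma vle_subRL n (x y c : 'cV[R]_n) : vle (x + y) c <-> vle x (c - y).
Proof. by split=> h i; have := h i; rewrite !mxE lerBrDr. Qed.

End Dotp.

Lemma lp_weak_duality (R : realType) t n (A : 'M[R]_(t, n)) b g l y :
  vle (A *m y) b -> vle 0 l -> A^T *m l = g -> dotp g y <= dotp l b.
Proof. by move=> Ayb l0 <-; rewrite dotp_trmx dotp_le. Qed.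

(** A direction of recession moves a feasible point arbitrarily far, so an
    objective bounded on the polyhedron cannot increase along it. *)
Lemma lp_recession (R : realType) t n (A : 'M[R]_(t, n)) b g (d : R) y0 y :
  (forall x, vle (A *m x) b -> dotp g x <= d) ->
  vle (A *m y0) b -> vle (A *m y) 0 -> dotp g y <= 0.
Proof.
move=> gd Ay0 Ay; rewrite leNgt; apply/negP => gy.
(* From [y0], a step of length [c] along [y] raises the objective above [d]. *)
pose c := (`|d - dotp g y0| + 1) / dotp g y.
have c0 : 0 < c by rewrite divr_gt0 // ltr_wpDl.
have /gd : vle (A *m (c *: y + y0)) b.
  move=> i; rewrite mulmx_coord_linear -[leRHS]add0r lerD // pmulr_rle0 //.
  by have := Ay i; rewrite [leRHS]mxE.
rewrite dotp_linear divfK ?gt_eqF //.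
by have := ler_norm (d - dotp g y0); lra.
Qed.

(** Homogenization: the Farkas lemma is applied in the variables [(y, s)] to the
    rows [A y - s b] and [- s], with [dotp g y - d s] as the implied functional.
    For [s > 0] the implication is the bound at [s^-1 *: y]. For [s = 0] it says
    that [g] does not increase along directions of recession; this is the only
    place where a feasible point, of the primal or of the dual, is used. The
    multiplier of [- s] is the slack in [dotp l b <= d]. *)
Lemma lp_strong_duality (R : realType) t n (A : 'M[R]_(t, n)) b g (d : R) :
  (forall y, vle (A *m y) b -> dotp g y <= d) ->
  (exists y, vle (A *m y) b) \/ (exists l, vle 0 l /\ A^T *m l = g) ->
  exists l, [/\ vle 0 l, A^T *m l = g & dotp l b <= d].
Proof.
move=> gd feas.
pose a (i : 'I_t.+1) (p : 'cV[R]_n * R^o) : R :=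
  if unlift ord0 i is Some j then (A *m p.1) j 0 - b j 0 * p.2 else - p.2.
have la i : scalar (a i).
  move=> c [x sx] [y sy]; rewrite /a /=; case: unlift => [j|].
    by rewrite mulmx_coord_linear /GRing.scale /=; ring.
  by rewrite /= /GRing.scale /=; ring.
pose h (p : 'cV[R]_n * R^o) : R := dotp g p.1 - d * p.2.
have lh : scalar h.
  move=> c [x sx] [y sy]; rewrite /h /= dotp_linear /GRing.scale /=; ring.
have [[y s] ay|l l0 hE] := farkas la lh.
  have s0 : 0 <= s by have := ay ord0; rewrite /a unlift_none /= oppr_le0.
  have Ay j : (A *m y) j 0 <= b j 0 * s.
    by have := ay (lift ord0 j); rewrite /a liftK /= subr_le0.
  rewrite /h /=; move: s0; rewrite le_eqVlt => /orP[/eqP s0|s0].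
    have {}Ay : vle (A *m y) 0.
      by move=> j; rewrite [leRHS]mxE; have := Ay j; rewrite -s0 mulr0.
    rewrite -s0 mulr0 subr0; case: feas => [[y0 Ay0]|[l [l0 lg]]].
      exact: lp_recession gd Ay0 Ay.
    by apply: le_trans (lp_weak_duality Ay l0 lg) _; rewrite dotp0r.
  have /gd : vle (A *m (s^-1 *: y)) b.
    by move=> j; rewrite -scalemxAr mxE mulrC ler_pdivrMr //; exact: Ay.
  rewrite dotpC /dotp.
  have -> : \sum_(i < n) (s^-1 *: y) i 0 * g i 0 = s^-1 * dotp g y.
    by rewrite /dotp mulr_sumr; apply: eq_bigr => i _; rewrite mxE; ring.
  by rewrite mulrC ler_pdivrMr // subr_le0.
pose u : 'cV[R]_t := \col_j l (lift ord0 j).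
have {}hE y s : dotp g y - d * s = dotp u (A *m y) - dotp u b * s - l ord0 * s.
  have := hE (y, s); rewrite /h /= big_ord_recl {1}/a unlift_none /= => ->.
  rewrite addrC mulrN; congr (_ - _); rewrite /dotp mulr_suml -sumrB.
  by apply: eq_bigr => j _; rewrite /a liftK [u _ _]mxE /=; ring.
exists u; split; first by move=> j; rewrite !mxE.
  (* [s = 0] isolates the dependence on [y]. *)
  apply: dotp_inj => y; rewrite dotp_trmx.
  by have := hE y 0; rewrite !mulr0 !subr0.
(* [y = 0], [s = 1] isolates the constants. *)
have := hE 0 1; rewrite mulmx0.
by rewrite !dotp0r; have := l0 ord0; lra.
Qed.

(** * The maximum norm as a maximum of linear functionals *)

Lemma dotp_hvec_pos (R : realType) u (k : 'I_(2 * u)) (i : 'I_u)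
    (w : 'cV[R]_u) :
  k = i :> nat -> dotp (hvec k) w = w i 0.
Proof.
move=> ki; rewrite /dotp (bigD1 i) //= big1 ?addr0 => [|j ji].
  by rewrite mxE ki ltn_ord eqxx mul1r.
by rewrite mxE ki ltn_ord (negPf ji : (j : nat) == i = false) mul0r.
Qed.

Lemma dotp_hvec_neg (R : realType) u (k : 'I_(2 * u)) (i : 'I_u)
    (w : 'cV[R]_u) :
  k = (u + i)%N :> nat -> dotp (hvec k) w = - w i 0.
Proof.
move=> ki; have kE : (k < u)%N = false by rewrite ki ltnNge leq_addr.
rewrite /dotp (bigD1 i) //= big1 ?addr0 => [|j ji].
  by rewrite mxE kE ki addKn eqxx mulN1r.
by rewrite mxE kE ki addKn (negPf ji : (j : nat) == i = false) oppr0 mul0r.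
Qed.

(** The functionals [hvec k] are the coordinates and their opposites. For
    [u = 0] there are none, and the right-hand side would not force [0 <= x]. *)
Lemma maxnorm_leP (R : realType) u (w : 'cV[R]_u) (x : R) : (0 < u)%N ->
  `|w| <= x <-> forall k : 'I_(2 * u), dotp (hvec k) w <= x.
Proof.
move=> u0; split=> [wx k|wx].
  have wi i : `|w i 0| <= x.
    apply: le_trans wx; rewrite [leRHS]/Num.norm /= mx_normrE.
    by apply: (le_bigmax _ (fun ij => `|w ij.1 ij.2|) (i, 0)).
  have [ku|uk] := ltnP k u.
    rewrite (dotp_hvec_pos (i := Ordinal ku)) //.
    exact: le_trans (ler_norm _) (wi _).
  have ku : (k - u < u)%N by rewrite ltn_subLR // addnn -mul2n.
  rewrite (dotp_hvec_neg (i := Ordinal ku)) /= ?subnKC //.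
  by apply: le_trans (ler_norm _) _; rewrite normrN.
have wi i : `|w i 0| <= x.
  have ku : (i < 2 * u)%N by rewrite (leq_trans (ltn_ord i)) // leq_pmull.
  have ku' : (u + i < 2 * u)%N by rewrite mul2n -addnn ltn_add2l.
  have := wx (Ordinal ku); rewrite (dotp_hvec_pos (i := i)) //.
  have := wx (Ordinal ku'); rewrite (dotp_hvec_neg (i := i)) // => ? ?.
  by rewrite ler_norml; lra.
rewrite [leLHS]/Num.norm /= mx_normrE bigmax_le => [//||[i j] _ /=].
  exact: le_trans (wi (Ordinal u0)).
by rewrite ord1.
Qed.

(** * Transfer of optimal values and minimizers along a map *)

(** Two problems related by a map [pr] that never increases the objective have
    the same value and, through [pr], the same minimizers, as soon as every
    point of finite objective downstairs has a preimage that is no worse: a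
    minimizer lifts to such a preimage, and points of infinite objective compete
    neither for the infimum nor as minimizers. *)
Lemma optimization_transfer (R : realType) (T1 T2 : Type) (S1 : set T1)
    (S2 : set T2) (f1 : T1 -> \bar R) (f2 : T2 -> \bar R) (pr : T2 -> T1) :
  (forall a, S2 a -> S1 (pr a) /\ (f1 (pr a) <= f2 a)%E) ->
  (forall x, S1 x -> (f1 x < +oo)%E ->
     exists a, [/\ S2 a, pr a = x & (f2 a <= f1 x)%E]) ->
  optimal_value S1 f1 = optimal_value S2 f2 /\
  forall x, minimizer S1 f1 x <-> exists a, minimizer S2 f2 a /\ pr a = x.
Proof.
move=> down up.
have low x : S1 x -> f1 x = +oo%E \/
    exists a, [/\ S2 a, pr a = x & (f2 a <= f1 x)%E].
  move=> Sx; have [fx|] := ltP (f1 x) +oo%E; first by right; exact: up.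
  by rewrite leye_eq => /eqP; left.
split.
  apply/le_anti/andP; split; apply: le_ereal_inf_tmp => _ [x Sx <-].
    have [Spx fx] := down x Sx.
    by apply: le_trans fx; apply: ereal_inf_lbound; exists (pr x).
  have [->|[a [Sa _ fa]]] := low x Sx; first exact: leey.
  by apply: le_trans fa; apply: ereal_inf_lbound; exists a.
move=> x; split=> [[Sx fx minx]|[a [[Sa fa mina] <-]]].
  have [a [Sa pa fa]] := up x Sx fx.
  exists a; split=> //; split=> //; first exact: le_lt_trans fa fx.
  move=> a' /down[Sp fp]; apply: le_trans fa _.
  by apply: le_trans fp; exact: minx.
have [Sp fp] := down a Sa; split=> //; first exact: le_lt_trans fp fa.
move=> x' /low[->|[a' [Sa' _ fa']]]; first exact: leey.
by apply: le_trans fp (le_trans _ fa'); exact: mina.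
Qed.

(** * Dualization of the loss of one sample *)

Section Sample.
Variables (R : realType) (t u v m r : nat) (W : Type).
Variables (Z : W -> set 'cV[int]_v).
Variables (phi1 : W -> 'cV[int]_v -> 'cV[R]_m).
Variables (phi2 : W -> 'cV[int]_v -> 'cV[R]_r).
Variable phi : signal R t u v W -> 'cV[R]_u * 'cV[int]_v -> 'cV[R]_(m * u + r).
Variable dz : 'cV[int]_v -> 'cV[int]_v -> R.
Variables (Q : 'M[R]_(u, m)) (q : 'cV[R]_r).
Variables (s : signal R t u v W) (xhat : 'cV[R]_u * 'cV[int]_v).
Hypothesis hphi : forall y z, dotp (param Q q) (phi s (y, z)) =
  dotp y (Q *m phi1 (sigw s) z) + dotp q (phi2 (sigw s) z).

Definition cut (z : 'cV[int]_v) (k : 'I_(2 * u)) (beta : R) (l : 'cV[R]_t) :=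
  dotp (param Q q) (phi s xhat)
    + dotp l (sigc s - sigB s *m intv z)
    - dotp q (phi2 (sigw s) z) + dotp (hvec k) xhat.1 + dz xhat.2 z <= beta.

Definition fiber_bound (z : 'cV[int]_v) (beta : R) : Prop :=
  forall y, mi_feasible Z s (y, z) ->
    dotp (param Q q) (phi s xhat - phi s (y, z)) + mi_dist dz xhat (y, z)
      <= beta.

(** The bound on the fiber separates over [k] because [`|yhat - y|] is the
    maximum over [k] of [dotp (hvec k) (yhat - y)]; in the resulting linear
    program for [k], the terms free of [y] are moved to the right-hand side. *)
Lemma fiber_boundP z beta : (0 < u)%N -> Z (sigw s) z ->
  fiber_bound z beta <->
  forall (k : 'I_(2 * u)) y, vle (sigA s *m y) (sigc s - sigB s *m intv z) ->
    dotp (- (Q *m phi1 (sigw s) z + hvec k)) y <=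
    beta - (dotp (param Q q) (phi s xhat) - dotp q (phi2 (sigw s) z)
            + dotp (hvec k) xhat.1 + dz xhat.2 z).
Proof.
move=> u0 Zz.
have feasE y : mi_feasible Z s (y, z) <->
    vle (sigA s *m y) (sigc s - sigB s *m intv z).
  by split=> [[/vle_subRL]|/vle_subRL].
have eqv y : dotp (param Q q) (phi s xhat - phi s (y, z))
    + mi_dist dz xhat (y, z) <= beta <->
  forall k : 'I_(2 * u), dotp (- (Q *m phi1 (sigw s) z + hvec k)) y <=
    beta - (dotp (param Q q) (phi s xhat) - dotp q (phi2 (sigw s) z)
            + dotp (hvec k) xhat.1 + dz xhat.2 z).
  rewrite dotpBr hphi /mi_dist /= addrA -lerBrDr addrC -lerBrDr.
  rewrite maxnorm_leP //; split=> dk k; have := dk k;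
    rewrite dotpBr [dotp (- _) _]dotpC dotpNr dotpDr (dotpC y (hvec k)); lra.
split=> [bd k y /feasE/bd/eqv//|bd y /feasE yz].
by apply/eqv => k; exact: bd.
Qed.

Lemma fiber_bound_of_cuts z beta : (0 < u)%N -> Z (sigw s) z ->
  (forall k : 'I_(2 * u),
     exists2 l, cut z k beta l & dual_feasible phi1 s Q z k l) ->
  fiber_bound z beta.
Proof.
move=> u0 Zz cuts; apply/fiber_boundP => // k y Ay.
have [l cutl [l0 lE]] := cuts k.
have lg : (sigA s)^T *m l = - (Q *m phi1 (sigw s) z + hvec k).
  by apply/eqP; rewrite -addr_eq0 addrC lE.
by apply: le_trans (lp_weak_duality Ay l0 lg) _; move: cutl; rewrite /cut; lra.
Qed.

Lemma cuts_of_fiber_bound z beta (k : 'I_(2 * u)) : (0 < u)%N -> Z (sigw s) z ->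
  (exists y, mi_feasible Z s (y, z)) \/
  (exists l, dual_feasible phi1 s Q z k l) ->
  fiber_bound z beta ->
  exists l, cut z k beta l /\ dual_feasible phi1 s Q z k l.
Proof.
move=> u0 Zz feas /fiber_boundP-/(_ u0 Zz k)/lp_strong_duality[|l [l0 lg lb]].
  case: feas => [[y [/vle_subRL Ay _]]|[l [l0 lE]]]; first by left; exists y.
  by right; exists l; split=> //; apply/eqP; rewrite -addr_eq0 addrC lE.
exists l; split; first by move: lb; rewrite /cut; lra.
by split=> //; rewrite lg subrr.
Qed.

Lemma subopt_loss_leP beta :
  (subopt_loss (mi_feasible Z) phi (mi_dist dz) (param Q q) s xhat
     <= beta%:E)%E <->
  forall z, Z (sigw s) z -> fiber_bound z beta.
Proof.
split=> [lossb z Zz y yz|bd].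
  rewrite -lee_fin; apply: le_trans lossb; apply: ereal_sup_ubound.
  by exists (y, z).
apply: ge_ereal_sup => _ [[y z] yz <-]; rewrite lee_fin.
by apply: bd => //; case: yz.
Qed.

(** [xhat] is feasible and contributes [dz xhat.2 xhat.2]. *)
Lemma subopt_loss_ge0 : (forall z z', 0 <= dz z z') -> mi_feasible Z s xhat ->
  (0 <= subopt_loss (mi_feasible Z) phi (mi_dist dz) (param Q q) s xhat)%E.
Proof.
move=> dz0 feas; apply: le_trans (ereal_sup_ubound _); last by exists xhat.
by rewrite lee_fin /mi_dist !subrr dotp0r normr0 !add0r.
Qed.

End Sample.

(** * The averaged objective *)

Section Objective.
Variables (R : realType) (S T : Type) (p N : nat) (kappa : R).
Variables (Reg : 'cV[R]_p -> R) (loss : 'cV[R]_p -> S -> T -> \bar R).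
Variables (s : 'I_N -> S) (xhat : 'I_N -> T).

Lemma regularized_objective_le theta (beta : 'I_N -> R) :
  (forall i, loss theta (s i) (xhat i) <= (beta i)%:E)%E ->
  (regularized_objective kappa Reg loss s xhat theta <=
   (kappa * Reg theta + N%:R^-1 * \sum_(i < N) beta i)%:E)%E.
Proof.
move=> lossb; rewrite /regularized_objective EFinD EFinM leeD2l //.
rewrite EFinM lee_wpmul2l ?lee_fin ?invr_ge0 //.
by rewrite -sumEFin; apply: lee_sum.
Qed.

(** Nonnegativity excludes [-oo], so one infinite loss would make the whole
    average [+oo]. *)
Lemma regularized_objective_fin theta :
  (forall i, 0 <= loss theta (s i) (xhat i))%E ->
  (regularized_objective kappa Reg loss s xhat theta < +oo)%E ->
  forall i, loss theta (s i) (xhat i) \is a fin_num.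
Proof.
move=> loss0 obj_fin i; rewrite ge0_fin_numE // ltNge leye_eq.
apply/negP => /eqP lossi; move: obj_fin; rewrite /regularized_objective.
have -> : (\sum_(j < N) loss theta (s j) (xhat j) = +oo)%E.
  apply/eqP; rewrite esum_eqy; last first.
    by move=> j _; rewrite -ltNye (lt_le_trans _ (loss0 j)).
  by apply/existsP; exists i; rewrite lossi eqxx.
by rewrite gt0_muley // lte_fin invr_gt0 ltr0n (leq_ltn_trans _ (ltn_ord i)).
Qed.

Lemma regularized_objective_fineE theta :
  (forall i, loss theta (s i) (xhat i) \is a fin_num) ->
  regularized_objective kappa Reg loss s xhat theta =
  (kappa * Reg theta
   + N%:R^-1 * \sum_(i < N) fine (loss theta (s i) (xhat i)))%:E.
Proof.
move=> lossf; rewrite EFinD EFinM (EFinM (N%:R^-1)) -sumEFin.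
by congr (_ + _ * _)%E; apply: eq_bigr => i _; rewrite fineK.
Qed.

End Objective.

Lemma param_surj (R : realType) u m r (theta : 'cV[R]_(m * u + r)) :
  exists (Q : 'M[R]_(u, m)) (q : 'cV[R]_r), theta = param Q q.
Proof.
exists (vec_mx (usubmx theta)^T)^T, (dsubmx theta).
by rewrite /param /vec trmxK vec_mxK trmxK vsubmxK.
Qed.

(** * The reformulation *)

Theorem corollary4p6 (R : realType) (t u v m r N : nat)
  (hu : (0 < u)%N) (hN : (0 < N)%N) (W : Type)
  (Z : W -> set 'cV[int]_v) (hZ : forall w, bounded_intset (Z w))
  (phi1 : W -> 'cV[int]_v -> 'cV[R]_m)
  (phi2 : W -> 'cV[int]_v -> 'cV[R]_r)
  (phi : signal R t u v W -> 'cV[R]_u * 'cV[int]_v -> 'cV[R]_(m * u + r))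
  (hphi : forall (Q : 'M[R]_(u, m)) (q : 'cV[R]_r)
                 (s : signal R t u v W) (y : 'cV[R]_u) (z : 'cV[int]_v),
     dotp (param Q q) (phi s (y, z)) =
     dotp y (Q *m phi1 (sigw s) z) + dotp q (phi2 (sigw s) z))
  (kappa : R) (hkappa : 0 <= kappa)
  (Reg : 'cV[R]_(m * u + r) -> R) (Theta : set 'cV[R]_(m * u + r))
  (dz : 'cV[int]_v -> 'cV[int]_v -> R) (hdz : forall z z', 0 <= dz z z')
  (s : 'I_N -> signal R t u v W) (xhat : 'I_N -> 'cV[R]_u * 'cV[int]_v)
  (hxhat : forall i, mi_feasible Z (s i) (xhat i))
  (M : 'I_N -> nat) (zs : forall i : 'I_N, 'I_(M i) -> 'cV[int]_v)
  (hzs_inj : forall i, injective (@zs i))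
  (hzs : forall i, range (@zs i) = Z (sigw (s i)))
  (* Proviso of linear programming duality for the inner maximizations over
     y: at parameters where the objective is finite, no inner program is
     infeasible together with its dual. *)
  (hLP : forall (Q : 'M[R]_(u, m)) (q : 'cV[R]_r),
     Theta (param Q q) ->
     (regularized_objective kappa Reg
        (subopt_loss (mi_feasible Z) phi (mi_dist dz)) s xhat (param Q q)
      < +oo)%E ->
     forall (i : 'I_N) (z : 'cV[int]_v) (k : 'I_(2 * u)),
       Z (sigw (s i)) z ->
       (exists y, mi_feasible Z (s i) (y, z)) \/
       (exists l, dual_feasible phi1 (s i) Q z k l)) :
  let obj := regularized_objective kappa Reg
               (subopt_loss (mi_feasible Z) phi (mi_dist dz)) s xhat in
  let refS := ref_feasible phi1 phi2 phi dz s xhat zs Theta in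
  let refobj := fun a => (ref_objective kappa Reg a)%:E in
  optimal_value Theta obj = optimal_value refS refobj /\
  forall theta : 'cV[R]_(m * u + r),
    minimizer Theta obj theta <->
    exists a : ref_var R t u m r N M, minimizer refS refobj a /\ rtheta a = theta.
Proof.
move=> obj refS refobj; apply: optimization_transfer => [a [Ta cuts]|theta].
  (* Weak duality: each [beta_i] bounds the loss of sample [i]. *)
  split=> //; apply: regularized_objective_le => i.
  have hphi_i y z := hphi (rQ a) (rq a) (s i) y z.
  apply/subopt_loss_leP => z Zz; apply: (fiber_bound_of_cuts hphi_i hu Zz) => k.
  move: Zz; rewrite -hzs => -[j _ <-].
  by have [cutl dual] := cuts i j k; exists (rlam a j k).
have [Q [q ->]] := param_surj theta => Ttheta obj_fin.
(* Strong duality, with the losses themselves as [beta]. *)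
have loss0 i := subopt_loss_ge0 phi Q q hdz (hxhat i).
have lossf := regularized_objective_fin loss0 obj_fin.
pose beta i := fine
  (subopt_loss (mi_feasible Z) phi (mi_dist dz) (param Q q) (s i) (xhat i)).
have Zzs i (j : 'I_(M i)) : Z (sigw (s i)) (zs i j) by rewrite -hzs; exists j.
have ex_lam i (j : 'I_(M i)) (k : 'I_(2 * u)) : exists l,
    cut phi2 phi dz Q q (s i) (xhat i) (zs i j) k (beta i) l /\
    dual_feasible phi1 (s i) Q (zs i j) k l.
  have hphi_i y z := hphi Q q (s i) y z.
  apply: (cuts_of_fiber_bound hphi_i hu (Zzs i j)).
    exact: hLP Ttheta obj_fin _ _ _ (Zzs i j).
  by move: (zs i j) (Zzs i j); apply/subopt_loss_leP; rewrite fineK.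
exists (RefVar Q q (fun i j k => sval (cid (ex_lam i j k))) beta); split=> //.
  by split=> // i j k /=; case: cid.
by rewrite /obj regularized_objective_fineE.
Qed.
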